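(* Let $(X,d)$ be a metric space and $\phi:X\to(-\infty,+\infty]$ a proper lower semicontinuous functional. Let the following assumptions hold: 1. for some $\lambda\le0$ the $\mathrm{EVI}_\lambda$-gradient flow $\mathsf S_t$ of $\phi$ exists in $D\subset\overline{\mathrm{Dom}(\phi)}$; 2. for some $\tau>0$, $\eta\ge0$ and $\varepsilon\ge0$ such that $4\gamma\tau\le1$, where $\gamma:=2\eta-3\lambda$, the sequence $(U^n)_{n\ge0}\subset D\cap\mathrm{Dom}(|\partial\phi|)$ satisfies for all integers $n\ge1$ $$\tau\big(1-\tfrac12\eta\tau\big)^2|\partial\phi|^2(U^n)\le\frac{d^2(U^n,U^{n-1})}\tau+\varepsilon,\qquad\Big(1-\tfrac{\eta-\lambda}2\tau\Big)\frac{d^2(U^n,U^{n-1})}\tau\le\phi(U^{n-1})-\phi(U^n)+\varepsilon.$$ Then, for all $u_0\in D$, the following estimate holds for every $t>0$: $$d\big(\mathsf S_t(u_0),\overline U(t)\big)\le e^{-\lambda t}d(u_0,U^0)+\big(\sqrt{\tau t_\tau}+t_\tau-t\big)e^{\gamma t_\tau}|\partial\phi|(U^0)+2\sqrt{\frac\varepsilon\tau\,t_\tau\,\mathsf E_{2\gamma}(t_\tau)}.$$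
   Context: $\mathrm{Dom}(\phi):=\{x\in X:\phi(x)<+\infty\}$. Metric slope: $|\partial\phi|(x):=+\infty$ if $x\notin\mathrm{Dom}(\phi)$; $:=0$ if $x\in\mathrm{Dom}(\phi)$ is isolated; $:=\limsup_{y\to x}\frac{(\phi(x)-\phi(y))^+}{d(x,y)}$ otherwise. $\mathrm{Dom}(|\partial\phi|):=\{x:|\partial\phi|(x)<+\infty\}$. $t_\tau:=\min\{k\tau:k\in\mathbb N,\ k\tau\ge t\}$. $\mathsf E_{a}(t):=\int_0^te^{ar}\,\mathrm dr$. $\overline U$ is the piecewise constant interpolant: $\overline U(t):=U^n$ if $t\in((n-1)\tau,n\tau]$, $\overline U(0):=U^0$. With $\frac{\mathrm d}{\mathrm dt}^{+}\zeta(t):=\limsup_{h\downarrow0}\frac{\zeta(t+h)-\zeta(t)}h$, a solution of $\mathrm{EVI}_\lambda(X,d,\phi)$ is a continuous curve $u:(0,+\infty)\to\mathrm{Dom}(\phi)$ with $\frac12\frac{\mathrm d}{\mathrm dt}^{+}d^2(u_t,v)+\frac\lambda2d^2(u_t,v)\le\phi(v)-\phi(u_t)$ for every $t>0$, $v\in\mathrm{Dom}(\phi)$. An $\mathrm{EVI}_\lambda$-gradient flow of $\phi$ in $D$ is a family of continuous maps $\mathsf S_t:D\to D$, $t\ge0$, such that for every $u_0\in D$: $\mathsf S_{t+h}(u_0)=\mathsf S_h(\mathsf S_t(u_0))$ for all $t,h\ge0$, $\lim_{t\downarrow0}\mathsf S_t(u_0)=\mathsf S_0(u_0)=u_0$,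 and $t\mapsto\mathsf S_t(u_0)$ is a solution of $\mathrm{EVI}_\lambda(X,d,\phi)$. *)

(* Defs.v *)
From HB Require Import structures.
From mathcomp Require Import all_boot all_order all_algebra.
From mathcomp Require Import all_classical all_reals all_analysis.

Set Implicit Arguments.
Unset Strict Implicit.
Unset Printing Implicit Defensive.
Import Order.TTheory GRing.Theory Num.Theory.
Import numFieldNormedType.Exports.

Local Open Scope classical_set_scope.
Local Open Scope ring_scope.

Section metric_gradient_flow.
Context {R : realType} {X : metricType R}.
Implicit Types (phi : X -> \bar R) (x v : X) (D : set X).

Definition Dom phi : set X := [set x | phi x < +oo]%E.

Definition proper_functional phi : Prop :=
  (forall x, phi x != -oo%E) /\ Dom phi !=set0.

(* For phi x finite, the quotient vanishes wherever phi y = +oo. *)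
Definition metric_slope phi x : \bar R :=
  (if phi x == +oo then +oo
   else if `[< isolated [set: X] x >] then 0
   else limf_esup (fun y => maxe (phi x - phi y) 0 * ((mdist x y)^-1)%:E)
                  (x^'))%E.

Definition upper_right_derivative (zeta : R -> R) (t : R) : \bar R :=
  limf_esup (fun h => ((zeta (t + h) - zeta t) / h)%:E) (0^'+).

(* Only the restriction of u to ]0, +oo[ matters. *)
Definition EVI_solution (lambda : R) phi (u : R -> X) : Prop :=
  [/\ {within [set` `]0, +oo[], continuous u},
      forall t, 0 < t -> Dom phi (u t) &
      forall t v, 0 < t -> Dom phi v ->
        ((2^-1)%:E *
           upper_right_derivative (fun s => mdist (u s) v ^+ 2)%R t
         + (lambda / 2 * mdist (u t) v ^+ 2)%:E <= phi v - phi (u t))%E].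

(* The maps D -> D are represented by total maps S t : X -> X which preserve D;
   their values outside D and for t < 0 play no role. *)
Definition EVI_gradient_flow (lambda : R) phi D (S : R -> X -> X) : Prop :=
  [/\ forall t, 0 <= t -> {homo S t : x / D x},
      forall t, 0 <= t -> {within D, continuous (S t)} &
      forall u0, D u0 ->
        [/\ forall t h, 0 <= t -> 0 <= h -> S (t + h) u0 = S h (S t u0),
            S t u0 @[t --> 0^'+] --> S 0 u0,
            S 0 u0 = u0 &
            EVI_solution lambda phi (fun t => S t u0)]].

(* For t >= 0 the default index 0 is used only at t = 0. *)
Definition pc_interpolant (tau : R) (U : nat -> X) (t : R) : X :=
  U (xget 0%N [set n : nat | (0 < n)%N /\ t \in `](n%:R - 1) * tau, n%:R * tau]]).

End metric_gradient_flow.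

Section time_grid.
Context {R : realType}.
Implicit Types (tau t : R).

(* The infimum is a minimum, see time_ceil_min. *)
Definition time_ceil tau t : R :=
  inf [set r | exists2 k : nat, r = k%:R * tau & t <= r].

Definition expR_primitive (a t : R) : R :=
  \int[lebesgue_measure]_(r in `[0, t]) expR (a * r).

Lemma time_ceil_min tau t : 0 < tau ->
  (exists2 k : nat, time_ceil tau t = k%:R * tau & t <= time_ceil tau t) /\
  (forall k : nat, t <= k%:R * tau -> time_ceil tau t <= k%:R * tau).
Proof.
move=> tau0; pose P (k : nat) := t <= k%:R * tau.
have exP : exists k, P k.
  exists (Num.bound `|t / tau|); rewrite /P -ler_pdivrMr//.
  by rewrite (le_trans (ler_norm _))// ltW// archi_boundP.
have [m Pm mmin] := ex_minnP exP.
suff -> : time_ceil tau t = m%:R * tau.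
  split=> [|k tk]; first by exists m.
  by rewrite ler_pM2r// ler_nat mmin.
apply/eqP; rewrite eq_le; apply/andP; split.
- apply: ge_inf; last by exists m.
  by exists t => r [].
- apply: lb_le_inf; first by exists (m%:R * tau), m.
  by move=> r [k ->] tk; rewrite ler_pM2r// ler_nat mmin.
Qed.

End time_grid.

Section interpolant_facts.
Context {R : realType} {X : metricType R}.
Implicit Types (tau t : R) (U : nat -> X).

Lemma pc_interpolant0 tau U : 0 < tau -> pc_interpolant tau U 0 = U 0%N.
Proof.
move=> tau0; rewrite /pc_interpolant xgetPN//= => n [n0].
rewrite in_itv/= ltNge => /andP[/negP + _]; apply.
by rewrite mulr_ge0 ?subr_ge0 ?ler1n ?(ltW tau0).
Qed.

Lemma pc_interpolantE tau U t n : 0 < tau -> (0 < n)%N ->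
  (n%:R - 1) * tau < t <= n%:R * tau -> pc_interpolant tau U t = U n.
Proof.
move=> tau0 n0 tn; rewrite /pc_interpolant; congr U.
apply: xget_unique; first by split; rewrite ?in_itv.
have aux (i j : nat) : (i%:R - 1) * tau < t -> t <= j%:R * tau -> (i <= j)%N.
  move=> ti tj; have := lt_le_trans ti tj; rewrite ltr_pM2r// ltrBlDr.
  by rewrite natr1 ltr_nat ltnS.
move=> m [m0]; rewrite in_itv/= => /andP[m1 m2]; move/andP: tn => [n1 n2].
by apply/eqP; rewrite eqn_leq !aux.
Qed.

End interpolant_facts.

(* Main.v *)
(** The curves S_t are handled only through one-sided comparison, without
    integrating the EVI.  If zeta(t) = d(S_t x, v)^2 and a differentiable barrier
    B satisfies mu B + 2 (phi v - phi (S_t x)) <= B' with mu = - lambda, then zeta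
    stays below B.  Suitable choices of B give the monotonicity of phi along the
    flow, the contraction d(S_t x, S_t y) <= e^(mu t) d(x, y), the bound |dphi|(x)
    on the initial speed, hence d(S_a x, S_b x) <= |dphi|(x) (E(b) - E(a)) with
    E(t) = E_mu(t), and the local error estimate
      d(S_t x, v)^2 <= e^(mu t) d(x, v)^2 - 2 E(t) (phi x - phi v) + (|dphi|(x) E(t))^2.
    For x = U^n, v = U^(n+1), t = tau the two hypotheses on U turn the right-hand
    side into q tau^2 (theta |dphi|^2(U^n) - |dphi|^2(U^(n+1))) + 4 eps tau, where
    theta = e^(2 gamma tau) and q = 1 - (2 eta + 2 mu) tau.  These terms telescope
    when the local errors are summed with the weights theta^(N-n), which dominate
    the expansion e^(2 mu tau) of the squared distance in one step, and the
    Cauchy-Schwarz inequality over the N steps produces the factor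
    sqrt(N) tau = sqrt(tau t_tau). *)
Require Import Defs.
From HB Require Import structures.
From mathcomp Require Import all_boot all_order all_algebra.
From mathcomp Require Import all_classical all_reals all_analysis.
From mathcomp Require Import ring lra.
Import Order.TTheory GRing.Theory Num.Theory.
Import numFieldNormedType.Exports.
Local Open Scope classical_set_scope.
Local Open Scope ring_scope.

Set Implicit Arguments.
Unset Strict Implicit.
Unset Printing Implicit Defensive.

(** * One-sided comparison for real functions *)

Section real_lemmas.
Context {R : realType}.
Implicit Types (a b c s t h : R) (g B : R -> R).

Lemma le_of_add_gt0_mul a b c : 0 <= c ->
  (forall r, 0 < r -> a <= b + r * c) -> a <= b.
Proof.
move=> c0 H; apply/ler_addgt0Pr => e e0.
have c1 : 0 < c + 1 by rewrite ltr_wpDl.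
apply: le_trans (H (e / (c + 1)) _) _; first by rewrite divr_gt0.
by rewrite lerD2l mulrAC ler_pdivrMr// ler_pM2l// lerDl.
Qed.

(** The supremum of the points of [[a, b]] satisfying [P] works: were [P] false there, it would be
    false on a whole left neighbourhood, which contains points approximating the supremum. *)
Lemma last_point (P : set R) a b : a <= b -> P a -> ~ P b ->
  (forall t, a < t <= b -> ~ P t -> \forall r \near t^'-, ~ P r) ->
  exists2 s, a <= s < b & P s /\ forall r, s < r <= b -> ~ P r.
Proof.
move=> ab Pa Pb Pleft; pose E := [set r | a <= r <= b /\ P r].
have Ea : E a by split; rewrite ?lexx.
have ubE : ubound E b by move=> r [/andP[]].
have supE : has_sup E by split; [exists a | exists b].
have aE : a <= sup E by apply: ub_le_sup => //; exists b.
have Eb : sup E <= b by apply: ge_sup => //; exists a.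
have PE : P (sup E).
  apply: contrapT => nP; have {}aE : a < sup E.
    by rewrite lt_neqAle aE andbT; apply: contra_notN nP => /eqP <-.
  have [|e /= e0 eP] := Pleft (sup E) _ nP; first by rewrite aE.
  have [r Er er] := sup_adherent e0 supE.
  have rE : r <= sup E by apply: ub_le_sup => //; exists b.
  case: (Er) => _ Pr; have {}rE : r < sup E.
    by rewrite lt_neqAle rE andbT; apply: contra_notN nP => /eqP <-.
  by apply: (eP r _ rE Pr); rewrite /= gtr0_norm ?subr_gt0//; lra.
exists (sup E).
  by rewrite aE lt_neqAle Eb andbT; apply: contra_notN Pb => /eqP <-.
split=> // r /andP[Er rb] Pr; have : r <= sup E.
  apply: ub_le_sup; first by exists b.
  by split => //; rewrite rb (le_trans aE (ltW Er)).
by rewrite leNgt Er.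
Qed.

(** At the last point where [g <= 0], continuity forces [g = 0]; the contact hypothesis then keeps
    [g <= 0] a little longer, a contradiction unless that point is [b]. *)
Lemma barrier g a b : a <= b -> {within `[a, b], continuous g} -> g a <= 0 ->
  (forall t, a <= t < b -> g t = 0 -> \forall h \near 0^'+, g (t + h) <= 0) ->
  g b <= 0.
Proof.
rewrite le_eqVlt => /predU1P[->//|ab] gc ga gbar; rewrite leNgt.
apply/negP => gb; have [gI gL gR] := (continuous_within_itvP g ab).1 gc.
have [|t /andP[at_ tb] /negP|s /andP[as_ sb] [gs sP]] :=
  @last_point (fun t => g t <= 0) a b (ltW ab) ga.
- by apply/negP; rewrite -ltNge.
- rewrite -ltNge => gt; have cg : g x @[x --> t^'-] --> g t.
    move: tb; rewrite le_eqVlt => /predU1P[->//|tb].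
    by apply: cvg_at_left_filter; apply: gI; rewrite in_itv/= at_.
  by apply: filterS (cvgr_gt _ cg _ gt) => r gr; apply/negP; rewrite -ltNge.
have cg : g x @[x --> s^'+] --> g s.
  move: as_; rewrite le_eqVlt => /predU1P[<-//|as_].
  by apply: cvg_at_right_filter; apply: gI; rewrite in_itv/= as_.
have {gs} gs : g s = 0.
  apply/eqP; rewrite eq_le gs leNgt; apply/negP => gs0.
  near s^'+ => r.
  suff /sP : s < r <= b by apply; near: r; apply: filterS (cvgr_lt _ cg _ gs0) => r /ltW.
  by apply/andP; split; near: r; [exact: nbhs_right_gt|exact: nbhs_right_le].
have sab : a <= s < b by rewrite as_ sb.
near (0 : R)^'+ => h.
suff /sP : s < s + h <= b by apply; near: h; exact: gbar.
rewrite ltrDl addrC -lerBrDr; apply/andP; split; near: h.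
- exact: nbhs_right_gt.
- by apply: nbhs_right_le; rewrite subr_gt0.
Unshelve. all: by end_near. Qed.

Lemma is_derive_right_ge B t c db : is_derive t 1 B db -> c < db ->
  \forall h \near 0^'+, c * h <= B (t + h) - B t.
Proof.
move=> [dB <-] cdb; have [e /= e0 Bc] := cvgr_gt _ dB _ cdb.
exists e => //= h he h0; have := Bc h he (negbT (gt_eqF h0)).
by rewrite /= /GRing.scale/= mulr1 (addrC h) mulrC ltr_pdivlMr// => /ltW.
Qed.

End real_lemmas.

(** * The primitive of an exponential in closed form *)

Section exp_primitive.
Context {R : realType}.
Implicit Types (a s t h : R).

(** Closed form of [expR_primitive] that stays differentiable on the whole line, whereas the
    integral over [[0, t]] vanishes for [t < 0]. *)
Definition exp_primitive a t := if a == 0 then t else (expR (a * t) - 1) / a.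

Lemma exp_primitive0 a : exp_primitive a 0 = 0.
Proof. by rewrite /exp_primitive mulr0 expR0 subrr mul0r if_same. Qed.

Lemma expR_exp_primitive a t : expR (a * t) = 1 + a * exp_primitive a t.
Proof.
rewrite /exp_primitive; have [->|a0] := eqVneq; first by rewrite !mul0r expR0 addr0.
by field.
Qed.

#[global] Instance is_derive_exp_primitive a t 
  : is_derive t 1 (exp_primitive a) (expR (a * t)).
Proof.
rewrite /exp_primitive; have [->|a0] := eqVneq.
  by rewrite mul0r expR0; exact: is_derive_id.
apply: is_derive_eq.
by rewrite /GRing.scale/=; field.
Qed.

Lemma exp_primitiveD a s t :
  exp_primitive a (s + t) = exp_primitive a s + expR (a * s) * exp_primitive a t.
Proof.
rewrite /exp_primitive; have [->|a0] := eqVneq; first by rewrite mul0r expR0 mul1r.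
by rewrite mulrDr expRD; field.
Qed.

Lemma exp_primitive_ge a t : 0 <= a -> 0 <= t -> t <= exp_primitive a t.
Proof.
rewrite le_eqVlt => /predU1P[<-|a0] t0; first by rewrite /exp_primitive eqxx.
rewrite /exp_primitive gt_eqF// ler_pdivlMr// lerBrDr addrC mulrC.
exact: expR_ge1Dx.
Qed.

Lemma exp_primitive_le a t : 0 <= a -> exp_primitive a t <= t * expR (a * t).
Proof.
rewrite le_eqVlt => /predU1P[<-|a0].
  by rewrite /exp_primitive eqxx mul0r expR0 mulr1.
rewrite /exp_primitive gt_eqF// ler_pdivrMr//.
have := expR_ge1Dx (- (a * t)); rewrite expRN -(ler_pM2r (expR_gt0 (a * t))).
by rewrite mulVf ?gt_eqF ?expR_gt0//; lra.
Qed.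

Lemma continuous_expRM a : continuous (fun t => expR (a * t)).
Proof.
by move=> t; apply: continuous_comp; [exact: mulrl_continuous|exact: continuous_expR].
Qed.

Lemma exp_primitive_near a : 0 <= a ->
  \forall h \near 0^'+, exp_primitive a h <= 2 * h.
Proof.
move=> a0; have ca := cvg_at_right_filter (@continuous_expRM a 0).
near=> h; have h0 : 0 < h by near: h; exact: nbhs_right_gt.
apply: le_trans (exp_primitive_le h a0) _; rewrite mulrC ler_pM2r//.
by near: h; apply: (cvgr_le _ ca); rewrite mulr0 expR0 ltr1n.
Unshelve. all: by end_near. Qed.

Lemma expR_primitiveE a t : 0 < t -> expR_primitive a t = exp_primitive a t.
Proof.
move=> t0; have ca := @continuous_expRM a.
have cE : continuous (exp_primitive a).
  move=> r; apply/differentiable_continuous/derivable1_diffP.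
  by have [] := is_derive_exp_primitive a r.
rewrite /expR_primitive /Rintegral (continuous_FTC2 t0 (F := exp_primitive a)).
- by rewrite exp_primitive0 -EFinB subr0.
- exact: continuous_subspaceT.
- split.
  + by move=> r _; have [] := is_derive_exp_primitive a r.
  + exact/cvg_at_right_filter/cE.
  + exact/cvg_at_left_filter/cE.
- by move=> r _; rewrite derive1E; have [] := is_derive_exp_primitive a r.
Qed.

End exp_primitive.

(** * Upper limits and distances along filters *)

Section metric_lemmas.
Context {R : realType} {X : metricType R}.

Lemma near_limf_esup_lt (T : choiceType) (Y : filteredType T) (F : set_system Y)
    (q : Y -> \bar R) (c : \bar R) : Filter F ->
  (limf_esup q F < c)%E -> \forall y \near F, (q y < c)%E.
Proof.
move=> FF /ereal_inf_lt[_ [V FV <-]] Vc; apply: filterS FV => y Vy.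
by apply: le_lt_trans Vc; apply: ereal_sup_ubound; exists y.
Qed.

Lemma cvg_mdist {T : Type} {F : set_system T} {FF : Filter F} (u v : T -> X) (x y : X) :
  u @ F --> x -> v @ F --> y -> mdist (u t) (v t) @[t --> F] --> mdist x y.
Proof.
move=> ux vy; apply/cvgrPdist_lt => /= e e0.
have e2 : 0 < e / 2 by rewrite divr_gt0.
near=> t.
have xt : mdist x (u t) < e / 2.
  by near: t; exact: metricType_numDomainType.cvgr_dist_lt.
have yt : mdist y (v t) < e / 2.
  by near: t; exact: metricType_numDomainType.cvgr_dist_lt.
have := metric_triangle x (u t) y; have := metric_triangle (u t) (v t) y.
have := metric_triangle (u t) x (v t); have := metric_triangle x y (v t).
by rewrite (metric_sym (v t) y) (metric_sym (u t) x) ltr_norml; lra.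
Unshelve. all: by end_near. Qed.

Lemma within_continuous_mdist (u v : R -> X) :
  {in `]0, +oo[, continuous u} -> u t @[t --> 0^'+] --> u 0 ->
  {in `]0, +oo[, continuous v} -> v t @[t --> 0^'+] --> v 0 ->
  {within `[0, +oo[, continuous (fun t => mdist (u t) (v t))}.
Proof.
move=> cu u0 cv v0; apply/continuous_within_itvcyP; split=> [t t0|].
  by apply: cvg_mdist; [exact: cu|exact: cv].
exact: cvg_mdist.
Qed.

End metric_lemmas.

(** * Energy decay and contraction from the EVI, with [mu] standing for [- lambda] *)

Section evi_flow.
Context {R : realType} {X : metricType R} {phi : X -> \bar R}.
Context {mu : R} {D : set X} {S : R -> X -> X}.
Context (phi_proper : proper_functional phi).
Context (phi_lsc : lower_semicontinuous phi) (mu_ge0 : 0 <= mu).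
Context (S_flow : EVI_gradient_flow (- mu) phi D S).
Local Notation d := mdist.
Local Notation f x := (fine (phi x)).
Local Notation E := (exp_primitive mu).

Lemma DomE v : Dom phi v -> phi v = (f v)%:E.
Proof.
move=> phiv; rewrite fineK// fin_numE (phi_proper.1 v)/=.
by rewrite lt_eqF.
Qed.

Lemma flow_in t x : 0 <= t -> D x -> D (S t x).
Proof. by case: S_flow => inD _ _ t0; exact: inD. Qed.

Lemma flow0 x : D x -> S 0 x = x.
Proof. by case: S_flow => _ _ /[apply] -[]. Qed.

Lemma flowD x t h : D x -> 0 <= t -> 0 <= h -> S (t + h) x = S h (S t x).
Proof. by case: S_flow => _ _ /[apply] -[+ _ _ _]; exact. Qed.

Lemma flow_cvg0 x : D x -> S t x @[t --> 0^'+] --> x.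
Proof. by case: S_flow => _ _ /[apply] -[_ /[swap] -> + _]. Qed.

Lemma flow_continuous x : D x -> {in `]0, +oo[, continuous (fun t => S t x)}.
Proof.
case: S_flow => _ _ /[apply] -[_ _ _ [+ _ _]].
rewrite continuous_open_subspace; last exact: interval_open.
by move=> cS t t0; apply: cS; rewrite inE.
Qed.

Lemma Dom_flow x t : D x -> 0 < t -> Dom phi (S t x).
Proof. by case: S_flow => _ _ /[apply] -[_ _ _ [_ domS _]] /domS. Qed.

Lemma flow_dist_continuous x v : D x ->
  {within `[0, +oo[, continuous (fun t => d (S t x) v)}.
Proof.
move=> Dx; apply: (@within_continuous_mdist _ _ (fun t => S t x) (cst v)).
- exact: flow_continuous.
- by rewrite flow0//; exact: flow_cvg0.
- by move=> t _; exact: cvg_cst.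
- exact: cvg_cst.
Qed.

(** The EVI puts the upper right derivative strictly below [c], so the difference quotients are
    eventually below [c]. *)
Lemma evi_near x v t c : D x -> Dom phi v -> 0 < t ->
  mu * d (S t x) v ^+ 2 + 2 * (f v - f (S t x)) < c ->
  \forall h \near 0^'+, d (S (t + h) x) v ^+ 2 - d (S t x) v ^+ 2 <= c * h.
Proof.
move=> Dx phiv t0 ltc; case: S_flow => _ _ /(_ x Dx)[_ _ _ [_ _ /(_ t v t0 phiv)]].
rewrite (DomE phiv) (DomE (Dom_flow Dx t0)).
set U := upper_right_derivative _ _ => evi.
have {evi} : (U < c%:E)%E.
  case: U evi => [u| |].
  - by rewrite -EFinM -EFinB -EFinD lee_fin lte_fin; lra.
  - by rewrite gt0_muley// lte_fin.
  - by rewrite ltNyr.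
move=> /near_limf_esup_lt Uc; near=> h.
have h0 : 0 < h by near: h; exact: nbhs_right_gt.
rewrite -ler_pdivrMr// -lee_fin; apply: ltW.
by near: h.
Unshelve. all: by end_near. Qed.

(* The inequality at a is strict, so that no contact occurs at t = a, where the
   EVI may fail (a = 0). *)
Lemma evi_barrier x v (a b : R) (B B' : R -> R) :
  D x -> Dom phi v -> 0 <= a -> a <= b -> (forall t : R, is_derive t 1 B (B' t)) ->
  d (S a x) v ^+ 2 < B a ->
  (forall t, a < t < b -> d (S t x) v ^+ 2 = B t ->
    mu * B t + 2 * (f v - f (S t x)) < B' t) ->
  d (S b x) v ^+ 2 <= B b.
Proof.
move=> Dx phiv a0 ab dB Ba Bt; rewrite -subr_le0.
apply: (@barrier _ (fun t => d (S t x) v ^+ 2 - B t) a b) => //.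
- have cB : continuous B.
    by move=> t; apply/differentiable_continuous/derivable1_diffP; have [] := dB t.
  have /continuous_subspaceW cd := @flow_dist_continuous x v Dx.
  move=> t; apply: cvgB; last exact: continuous_subspaceT.
  under [X in X @ _]eq_fun do rewrite expr2.
  by apply: cvgM; apply: cd => r /=; rewrite !in_itv/= => /andP[ar _];
    rewrite (le_trans a0 ar).
- by rewrite subr_le0 ltW.
- move=> t /andP[at_ tb] /eqP; rewrite subr_eq0 => /eqP tE.
  have {}at_ : a < t.
    by move: at_; rewrite le_eqVlt => /predU1P[ta|//]; move: Ba; rewrite ta tE ltxx.
  have atb : a < t < b by rewrite at_ tb.
  have Bt' := Bt t atb tE.
  (* The midpoint between the growth rate allowed by the EVI and [B' t] leaves strict room on both
     sides. *)
  pose c := (mu * B t + 2 * (f v - f (S t x)) + B' t) / 2.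
  have c1 : mu * d (S t x) v ^+ 2 + 2 * (f v - f (S t x)) < c by rewrite tE /c; lra.
  have c2 : c < B' t by rewrite /c; lra.
  near=> h.
  have : d (S (t + h) x) v ^+ 2 - d (S t x) v ^+ 2 <= c * h.
    by near: h; apply: evi_near => //; exact: le_lt_trans at_.
  have : c * h <= B (t + h) - B t by near: h; exact: is_derive_right_ge.
  by rewrite tE; lra.
Unshelve. all: by end_near. Qed.

(** Non-strict version: adding [r * w] to the barrier makes both inequalities strict, since w' = mu
    w + e^(mu t) > mu w, and then r tends to 0. *)
Lemma evi_comparison x v (a b : R) (B B' : R -> R) :
  D x -> Dom phi v -> 0 <= a -> a <= b -> (forall t : R, is_derive t 1 B (B' t)) ->
  d (S a x) v ^+ 2 <= B a ->
  (forall t, a < t < b -> mu * B t + 2 * (f v - f (S t x)) <= B' t) ->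
  d (S b x) v ^+ 2 <= B b.
Proof.
move=> Dx phiv a0 ab dB Ba Bt.
pose w t := expR (mu * t) * (1 + t).
have w0 t : 0 <= t -> 0 < w t by move=> t0; rewrite mulr_gt0 ?expR_gt0//; lra.
apply: (@le_of_add_gt0_mul _ _ _ (w b)) => [|r r0].
  by rewrite ltW// w0// (le_trans a0 ab).
apply: (@evi_barrier x v a b (fun t => B t + r * w t)
  (fun t => B' t + r * (mu * w t + expR (mu * t)))) => //.
- move=> t; apply: is_deriveD; apply: is_deriveZ => /=.
  apply: is_derive_eq; rewrite /GRing.scale/= /w; ring.
- by rewrite ltr_pwDr// mulr_gt0// w0.
- move=> t atb _; have := Bt t atb.
  suff : 0 < r * expR (mu * t) by lra.
  by rewrite mulr_gt0// expR_gt0.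
Qed.

Lemma near_lsc (x : X) c : Dom phi x -> c < f x ->
  \forall y \near x, Dom phi y -> c < f y.
Proof.
move=> phix; rewrite -lte_fin -(DomE phix) => /phi_lsc[V xV Vc].
by apply: filterS xV => y /Vc cy phiy; rewrite -lte_fin -(DomE phiy).
Qed.

Lemma flow_lsc x c : D x -> Dom phi x -> c < f x ->
  \forall h \near 0^'+, c < f (S h x).
Proof.
move=> Dx phix cx; near=> h; have : Dom phi (S h x) by exact: Dom_flow.
near: h; exact: (flow_cvg0 Dx (near_lsc phix cx)).
Unshelve. all: by end_near. Qed.

(* If phi (S_t x) > phi (S_s x), then after the last time r with
   phi (S_r x) <= phi (S_s x) the EVI with v = S_r x freezes the curve at S_r x. *)
Lemma flow_nonincreasing x s t : D x -> 0 <= s -> s <= t -> Dom phi (S s x) ->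
  f (S t x) <= f (S s x).
Proof.
move=> Dx s0; rewrite le_eqVlt => /predU1P[<-//|st] phis.
have phi_gt r : s < r -> Dom phi (S r x) by move=> sr; exact/Dom_flow/(le_lt_trans s0 sr).
rewrite leNgt; apply/negP => fst.
pose P r := Dom phi (S r x) /\ f (S r x) <= f (S s x).
have [|||r /andP[sr rt] [[phir fr] rP]] := @last_point _ P s t (ltW st).
- by split.
- by case=> _; rewrite leNgt fst.
- move=> r /andP[sr rt] nPr; have phir := phi_gt _ sr.
  have fr : f (S s x) < f (S r x).
    by rewrite ltNge; apply: contra_notN nPr => fr; split.
  have cS : S q x @[q --> r^'-] --> S r x.
    apply/cvg_at_left_filter/(flow_continuous Dx).
    by rewrite in_itv/= andbT (le_lt_trans s0 sr).
  have nq : \forall q \near r^'-, Dom phi (S q x) -> f (S s x) < f (S q x).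
    exact: cS (near_lsc phir fr).
  apply: filterS nq => q fq [/fq].
  by rewrite leNgt => ->.
have : d (S t x) (S r x) ^+ 2 <= 0.
  apply: (@evi_comparison x (S r x) r t (cst 0) (cst 0)) => //.
  - by rewrite (le_trans s0).
  - exact: ltW.
  - by rewrite mdistxx expr0n.
  - move=> q /andP[rq qt]; rewrite mulr0 add0r.
    suff : f (S s x) < f (S q x) by rewrite /=; lra.
    rewrite ltNge; apply/negP => fq; apply: (rP q); first by rewrite rq ltW.
    by split=> //; apply: phi_gt; exact: le_lt_trans rq.
rewrite real_exprn_even_le0 ?num_real//= => /eqP/mdist_positivity tr.
by move: fst; rewrite tr ltNge fr.
Qed.

(** The barrier solves B' = mu B + 2 K with the energy frozen at its final value, the smallest on
    the interval by monotonicity. Thus [phi x] need not be finite. *)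
Lemma evi_exp x v t : D x -> Dom phi v -> 0 <= t ->
  d (S t x) v ^+ 2 <= expR (mu * t) * d x v ^+ 2 + 2 * E t * (f v - f (S t x)).
Proof.
move=> Dx phiv t0; set K := f v - _.
apply: (@evi_comparison x v 0 t
  (fun r => expR (mu * r) * d x v ^+ 2 + 2 * E r * K)
  (fun r => expR (mu * r) * (mu * d x v ^+ 2 + 2 * K))) => //.
- move=> r; apply: is_derive_eq; rewrite /GRing.scale/=; ring.
- by rewrite flow0// mulr0 expR0 exp_primitive0; lra.
- move=> r /andP[r0 rt]; rewrite expR_exp_primitive.
  have := flow_nonincreasing Dx (ltW r0) (ltW rt) (Dom_flow Dx r0).
  by rewrite /K; lra.
Qed.

(** At a contact time, [evi_exp] is used over a time [h] twice: from [u] against [S h w], and from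
    [w] against [u]. In the sum the energy of [S h w] cancels to first order, and lower
    semicontinuity makes the remaining energy difference o(h). *)
Lemma flow_contraction x y t : D x -> D y -> 0 <= t ->
  d (S t x) (S t y) <= expR (mu * t) * d x y.
Proof.
move=> Dx Dy b0; move: t b0 => b b0.
pose B r t := expR (mu * t) ^+ 2 * (d x y ^+ 2 + r * (1 + t)).
suff Bb : d (S b x) (S b y) ^+ 2 <= (expR (mu * b) * d x y) ^+ 2.
  by rewrite -(@ler_pXn2r _ 2) ?nnegrE ?mdist_ge0// mulr_ge0 ?mdist_ge0// expR_ge0.
apply: (@le_of_add_gt0_mul _ _ _ (expR (mu * b) ^+ 2 * (1 + b))) => [|r r0].
  by rewrite mulr_ge0 ?exprn_ge0 ?expR_ge0//; lra.
suff : d (S b x) (S b y) ^+ 2 <= B r b by rewrite /B; lra.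
rewrite -subr_le0.
apply: (@barrier _ (fun t => d (S t x) (S t y) ^+ 2 - B r t) 0 b) => //.
- have cB : continuous (B r).
    move=> t; apply/differentiable_continuous/derivable1_diffP.
    exact: ex_derive.
  have cd : {within `[0, b], continuous (fun t => d (S t x) (S t y))}.
    have /continuous_subspaceW : {within `[0, +oo[, continuous (fun t => d (S t x) (S t y))}.
      apply: within_continuous_mdist; rewrite ?flow0//;
        [exact: flow_continuous|exact: flow_cvg0|exact: flow_continuous|exact: flow_cvg0].
    by apply => t /=; rewrite !in_itv/= => /andP[->].
  move=> t; apply: cvgB; last exact: continuous_subspaceT.
  under [X in X @ _]eq_fun do rewrite expr2.
  by apply: cvgM; exact: cd.
- by rewrite /B !flow0// mulr0 expR0; lra.
- move=> t /andP[t0 tb] /eqP; rewrite subr_eq0 => /eqP tB.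
  (* No contact at time 0, where the energies may be infinite: [B r 0] exceeds [d x y ^+ 2] by
     [r]. *)
  have {}t0 : 0 < t.
    move: t0; rewrite le_eqVlt => /predU1P[t0|//]; move: tB.
    by rewrite -t0 /B !flow0// mulr0 expR0; lra.
  pose u := S t x; pose w := S t y.
  have Du : D u by apply: flow_in => //; exact: ltW.
  have Dw : D w by apply: flow_in => //; exact: ltW.
  have phiu : Dom phi u by exact: Dom_flow.
  have phiw : Dom phi w by exact: Dom_flow.
  (* The energy terms will be at most 2 E(h) 2 k <= 8 k h = r h, which is the slack gained by [B r]
     over time [h]. *)
  pose k := r / 8; have k0 : 0 < k by rewrite divr_gt0.
  pose M := `|f u - f w| + 1.
  have M0 : 0 < M by rewrite ltr_wpDl.
  near=> h; have h0 : 0 < h by near: h; exact: nbhs_right_gt.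
  have Eh0 : 0 <= E h by apply: le_trans (exp_primitive_ge mu_ge0 (ltW h0)); exact: ltW.
  have Eh : E h <= 2 * h by near: h; exact: exp_primitive_near.
  have phiuh : Dom phi (S h u) by exact: Dom_flow.
  have phiwh : Dom phi (S h w) by exact: Dom_flow.
  have fu : f u - k < f (S h u).
    near: h; apply: flow_lsc => //; lra.
  have fw : f w - 1 < f (S h w).
    near: h; apply: flow_lsc => //; lra.
  have muh : h <= k / (2 * (mu * M + 1)).
    near: h; apply: nbhs_right_le.
    by rewrite divr_gt0// mulr_gt0// ltr_wpDl// mulr_ge0// ltW.
  have uw := evi_exp Du phiwh (ltW h0).
  have wu := evi_exp Dw phiu (ltW h0).
  rewrite subr_le0 (flowD Dx (ltW t0) (ltW h0)) (flowD Dy (ltW t0) (ltW h0)) -/u -/w.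
  have Bth : expR (mu * h) ^+ 2 * B r t + r * h <= B r (t + h).
    rewrite /B (mulrDr mu) expRD; set e1 := expR (mu * t); set e2 := expR (mu * h).
    have e11 : 1 <= e1 by rewrite -expR0 ler_expR mulr_ge0// ltW.
    have e21 : 1 <= e2 by rewrite -expR0 ler_expR mulr_ge0// ltW.
    have : 1 <= (e1 * e2) ^+ 2 by rewrite exprn_ege1// mulr_ege1.
    rewrite -(ler_pM2r (mulr_gt0 r0 h0)); lra.
  apply: le_trans Bth; rewrite -tB -/u -/w.
  rewrite (metric_sym u (S h w)) in uw.
  rewrite (metric_sym w u) in wu.
  have e0 := expR_gt0 (mu * h).
  (* Multiplying by e^(mu h) = 1 + mu E(h) lets the two estimates be chained through
     [d (S h w) u]. *)
  rewrite -(ler_pM2l e0) in wu.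
  have muE : mu * E h * (f u - f (S h w)) <= k.
    have fM : f u - f (S h w) <= M.
      rewrite /M; have := ler_norm (f u - f w); lra.
    have : mu * E h * (f u - f (S h w)) <= mu * E h * M.
      by apply: ler_wpM2l => //; rewrite mulr_ge0.
    have : mu * E h * M <= mu * (2 * h) * M.
      by rewrite ler_pM2r// ler_wpM2l.
    move: muh; rewrite ler_pdivlMr; last by rewrite mulr_gt0// ltr_wpDl// mulr_ge0// ltW.
    lra.
  have : 2 * E h * (mu * E h * (f u - f (S h w)) + (f u - f (S h u))) <= 2 * E h * (2 * k).
    by apply: ler_wpM2l; [rewrite mulr_ge0|lra].
  have : E h * k <= 2 * h * k by rewrite ler_pM2r.
  move: uw wu; rewrite expR_exp_primitive /k; lra.
Unshelve. all: by end_near. Qed.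

(** * The metric slope: sign and local linear bound *)

Lemma metric_slopeP x : Dom (metric_slope phi) x ->
  [/\ Dom phi x, 0 <= fine (metric_slope phi x) &
      metric_slope phi x = (fine (metric_slope phi x))%:E].
Proof.
move=> slx; have phix : Dom phi x.
  rewrite /Dom/= ltey; apply/eqP => phix.
  by move: slx; rewrite /Dom/= /metric_slope phix eqxx.
have : (0 <= metric_slope phi x)%E.
  rewrite /metric_slope lt_eqF//; case: ifPn => // /asboolPn niso.
  (* The upper limit of nonnegative quotients is nonnegative only along a proper filter; punctured
     neighbourhoods form one because [x] is not isolated. *)
  apply: limf_esup_ge0 => [x0|y]; last first.
    by rewrite mule_ge0 ?lee_fin ?invr_ge0 ?mdist_ge0// le_max lexx orbT.
  apply: niso; split; first by rewrite inE.
  exists [set x]; last by rewrite setIT.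
  have {}x0 : \forall y \near x, y != x -> False by exact: x0.
  by apply: filterS x0 => y xy /=; apply: contrapT => /eqP /xy.
by move: slx; rewrite /Dom/=; case: (metric_slope phi x).
Qed.

Lemma metric_slope_near x s : Dom (metric_slope phi) x ->
  fine (metric_slope phi x) < s ->
  \forall y \near x, Dom phi y -> f x - f y <= s * d x y.
Proof.
move=> slx; have [phix _ slE] := metric_slopeP slx.
rewrite -lte_fin -slE /metric_slope lt_eqF//; case: ifPn => [/asboolP[_ [V xV]]|_].
  rewrite setIT => Vx _; apply: filterS xV => y; rewrite Vx => -> _.
  by rewrite mdistxx mulr0 subrr.
move=> /near_limf_esup_lt xs.
have {}xs : \forall y \near x, y != x ->
  (maxe (phi x - phi y) 0 * ((d x y)^-1)%:E < s%:E)%E by exact: xs.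
apply: filterS xs => y ys phiy; have [->|yx] := eqVneq y x.
  by rewrite mdistxx mulr0 subrr.
have xy0 : 0 < d x y by rewrite mdist_gt0 eq_sym.
rewrite -ler_pdivrMr// ltW// -lte_fin; apply: le_lt_trans (ys yx).
rewrite (DomE phix) (DomE phiy) EFinM -EFinB; apply: lee_wpmul2r.
  by rewrite lee_fin invr_ge0 ltW.
by rewrite le_max lexx.
Qed.

(** * Flow estimates from a starting point of finite slope *)

Section slope_bounds.
Context {x : X} (Dx : D x) (slx : Dom (metric_slope phi) x).
Local Notation s := (fine (metric_slope phi x)).

Let phix : Dom phi x. Proof. by have [] := metric_slopeP slx. Qed.
Let s0 : 0 <= s. Proof. by have [] := metric_slopeP slx. Qed.

(* Comparison of d(S_t x, x)^2 with (r t + k)^2, k > 0, instead of bounding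
   phi x - phi (S_t x) at the final time, which would lose a factor 2. *)
Lemma flow_initial_speed r : s < r -> \forall h \near 0^'+, d (S h x) x <= r * h.
Proof.
(* At contact the slope term is at most 2 q (r t + k) and the [mu] term is below (r - s)(r t + k).
   As 2 q + r - s = 2 r, the sum stays below the derivative of the barrier. *)
move=> sr; pose q := (s + r) / 2.
have sq : s < q by rewrite /q; lra.
have mur : 0 < (r - s) / (mu + 1).
  by rewrite divr_gt0 ?subr_gt0// ltr_wpDl.
have [e /= e0 He] : \forall h \near 0^'+,
    f x - f (S h x) <= q * d (S h x) x /\ mu * d (S h x) x < r - s.
  near=> h; have h0 : 0 < h by near: h; exact: nbhs_right_gt.
  rewrite (metric_sym (S h x)); split.
    have : Dom phi (S h x) by exact: Dom_flow.
    near: h; exact: (flow_cvg0 Dx (metric_slope_near slx sq)).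
  have : d x (S h x) < (r - s) / (mu + 1).
    near: h; apply: metricType_numDomainType.cvgr_dist_lt mur.
    exact: flow_cvg0.
  rewrite ltr_pdivlMr; last by rewrite ltr_wpDl.
  have := mdist_ge0 x (S h x); lra.
exists e => //= h he h0; apply: (@le_of_add_gt0_mul _ _ _ 1) => // k k0.
rewrite mulr1; have r0 : 0 < r by rewrite (le_lt_trans s0 sr).
have rhk : 0 <= r * h + k by rewrite addr_ge0 ?mulr_ge0 ?ltW.
rewrite -(@ler_pXn2r _ 2) ?nnegrE ?mdist_ge0//.
apply: (@evi_barrier x x 0 h (fun t => (r * t + k) ^+ 2)
  (fun t => 2 * (r * t + k) * r)) => //.
- exact: ltW.
- by move=> t; apply: is_derive_eq; rewrite /GRing.scale/=; ring.
- by rewrite flow0// mdistxx mulr0 add0r expr0n/= exprn_gt0.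
- move=> t /andP[t0 th] tB.
  have rtk : 0 < r * t + k by rewrite addr_gt0 ?mulr_gt0.
  have dE : d (S t x) x = r * t + k.
    by apply/eqP; rewrite -(@eqrXn2 _ 2)// ?mdist_ge0 ?ltW// tB.
  have [|] := He t _ t0.
    rewrite /= sub0r normrN gtr0_norm//; apply: lt_trans th _.
    by move: he; rewrite /= sub0r normrN gtr0_norm.
  rewrite dE => ft mut; rewrite expr2 mulrA.
  have : mu * (r * t + k) * (r * t + k) < (r - s) * (r * t + k) by rewrite ltr_pM2r.
  by move: ft; rewrite /q; lra.
Unshelve. all: by end_near. Qed.

(** This is [evi_exp] at a small time [h] divided by 2 E(h): the initial speed bounds the decrease
    of the squared distance by 2 d(x, v) (s + e) E(h), and lower semicontinuity brings [f (S h x)]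
    back to [f x]. *)
Lemma slope_global v : Dom phi v -> f x - f v <= s * d x v + mu / 2 * d x v ^+ 2.
Proof.
move=> phiv; apply: (@le_of_add_gt0_mul _ _ _ (d x v + 1)) => [|e e0].
  by rewrite addr_ge0// mdist_ge0.
have v0 := mdist_ge0 x v; have se0 : 0 <= s + e by rewrite addr_ge0// ltW.
near (0 : R)^'+ => h.
have h0 : 0 < h by near: h; exact: nbhs_right_gt.
have Eh : h <= E h by exact: exp_primitive_ge mu_ge0 (ltW h0).
have Eh0 : 0 < E h by exact: lt_le_trans Eh.
have fh : f x - e < f (S h x) by near: h; apply: flow_lsc => //; lra.
have dh : d (S h x) x <= (s + e) * E h.
  have : d (S h x) x <= (s + e) * h by near: h; apply: flow_initial_speed; lra.
  move=> /le_trans; apply; exact: ler_wpM2l.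
have := evi_exp Dx phiv (ltW h0); rewrite expR_exp_primitive => evi.
have tri := metric_triangle x (S h x) v; rewrite (metric_sym x (S h x)) in tri.
have q0 := mdist_ge0 (S h x) v.
have dq : d x v ^+ 2 - d (S h x) v ^+ 2 <= 2 * d x v * ((s + e) * E h).
  have [vq|qv] := leP (d x v) (d (S h x) v).
    have : d x v ^+ 2 <= d (S h x) v ^+ 2 by rewrite ler_pXn2r// nnegrE.
    have : 0 <= 2 * d x v * ((s + e) * E h).
      by rewrite !mulr_ge0// ltW.
    lra.
  rewrite subr_sqr.
  apply: (@le_trans _ _ ((d x v - d (S h x) v) * (2 * d x v))).
    by apply: ler_wpM2l; lra.
  by rewrite mulrC ler_wpM2l//; [rewrite mulr_ge0|lra].
have : 2 * E h * (f (S h x) - f v) <= 2 * E h * ((s + e) * d x v + mu / 2 * d x v ^+ 2).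
  lra.
rewrite ler_pM2l; last by rewrite mulr_gt0.
lra.
Unshelve. all: by end_near. Qed.

(** Contraction carries the initial speed to time t: S_(t+h) x = S_t (S_h x) is within e^(mu t) (s +
    e) h of S_t x, and E' = e^(mu t). *)
Lemma flow_displacement a b : 0 <= a -> a <= b -> d (S a x) (S b x) <= s * (E b - E a).
Proof.
move=> a0 ab.
have Emono t h : 0 <= t -> 0 <= h -> expR (mu * t) * h <= E (t + h) - E t.
  move=> t0 h0; rewrite exp_primitiveD addrC addKr ler_pM2l ?expR_gt0//.
  exact: exp_primitive_ge.
apply: (@le_of_add_gt0_mul _ _ _ (E b - E a)) => [|e e0].
  have := Emono a (b - a) a0; rewrite subrKC subr_ge0 => /(_ ab).
  by apply: le_trans; rewrite mulr_ge0 ?expR_ge0 ?subr_ge0.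
rewrite -mulrDl metric_sym -subr_le0; pose B t := (s + e) * (E t - E a).
apply: (@barrier _ (fun t => d (S t x) (S a x) - B t) a b) => //.
- have cB : continuous B.
    move=> t; apply/differentiable_continuous/derivable1_diffP.
    exact: ex_derive.
  have /continuous_subspaceW cd := @flow_dist_continuous x (S a x) Dx.
  move=> t; apply: cvgB; last exact: continuous_subspaceT.
  by apply: cd => r /=; rewrite !in_itv/= => /andP[ar _];
    rewrite (le_trans a0 ar).
- by rewrite /B mdistxx !subrr mulr0 subrr.
- move=> t /andP[at_ tb] /eqP; rewrite subr_eq0 => /eqP tE.
  have t0 : 0 <= t by exact: le_trans at_.
  near=> h; have h0 : 0 < h by near: h; exact: nbhs_right_gt.
  have St : S (t + h) x = S t (S h x) by rewrite addrC flowD// ltW.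
  rewrite subr_le0; apply: le_trans (metric_triangle _ (S t x) _) _.
  rewrite tE St /B; have := flow_contraction (flow_in (ltW h0) Dx) Dx t0.
  have : d (S h x) x <= (s + e) * h by near: h; apply: flow_initial_speed; lra.
  rewrite -(ler_pM2l (expR_gt0 (mu * t))) => hx.
  have se0 : 0 <= s + e by rewrite addr_ge0// ltW.
  have := ler_wpM2l se0 (Emono t h t0 (ltW h0)); move: hx.
  lra.
Unshelve. all: by end_near. Qed.

Lemma flow_energy t : 0 < t ->
  f x - f (S t x) <= s ^+ 2 * E t + mu / 2 * s ^+ 2 * E t ^+ 2.
Proof.
move=> t0; have := slope_global (Dom_flow Dx t0).
have := flow_displacement (lexx 0) (ltW t0).
rewrite flow0// exp_primitive0 subr0; set q := d _ _ => qE fq.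
have q0 : 0 <= q by exact: mdist_ge0.
have E0 : 0 <= E t by apply: le_trans (exp_primitive_ge mu_ge0 (ltW t0)); exact: ltW.
apply: (le_trans fq); apply: lerD.
  by rewrite expr2 -mulrA ler_wpM2l.
rewrite -[leRHS]mulrA -exprMn; apply: ler_wpM2l; first by rewrite divr_ge0.
by rewrite ler_pXn2r// nnegrE mulr_ge0.
Qed.

(** Here B' - mu B equals 2 (phi v - phi x) plus twice the bound of [flow_energy], so the comparison
    condition is exactly that bound. *)
Lemma flow_local_error v t : Dom phi v -> 0 <= t ->
  d (S t x) v ^+ 2 <=
    expR (mu * t) * d x v ^+ 2 - 2 * E t * (f x - f v) + s ^+ 2 * E t ^+ 2.
Proof.
move=> phiv t0.
apply: (@evi_comparison x v 0 t
  (fun t => expR (mu * t) * d x v ^+ 2 - 2 * E t * (f x - f v) + s ^+ 2 * E t ^+ 2)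
  (fun t => expR (mu * t) * (mu * d x v ^+ 2 - 2 * (f x - f v) + 2 * s ^+ 2 * E t)))
  => //.
- by move=> r; apply: is_derive_eq; rewrite /GRing.scale/=; ring.
- by rewrite flow0// mulr0 expR0 exp_primitive0; lra.
- move=> r /andP[r0 rt]; have := flow_energy r0.
  by rewrite expR_exp_primitive; lra.
Qed.

End slope_bounds.

End evi_flow.

(** * Discrete summation and the one-step error *)

Section discrete_estimates.
Context {R : realType}.

(** Induction on D_N^2 <= N T_N, where [T] obeys theta T_N + e_(N+1)^2 <= T_(N+1). The step is (x +
    y)^2 <= (N + 1) (x^2 / N + y^2), whence the separate case N = 0. *)
Lemma discrete_gronwall (sigma theta k : R) (D e A : nat -> R) :
  0 <= sigma -> sigma ^+ 2 <= theta -> D 0 = 0 -> (forall n, 0 <= D n) ->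
  (forall n, D n.+1 <= sigma * D n + e n.+1) ->
  (forall n, e n.+1 ^+ 2 <= theta * A n - A n.+1 + k) ->
  forall N, D N ^+ 2 <= N%:R * (theta ^+ N * A 0 - A N + k * \sum_(i < N) theta ^+ i).
Proof.
move=> s0 st D0 Dge0 De eA N.
have t0 : 0 <= theta by rewrite (le_trans _ st)// exprn_ge0.
pose T n := theta ^+ n * A 0 - A n + k * \sum_(i < n) theta ^+ i.
have TS n : theta * T n + e n.+1 ^+ 2 <= T n.+1.
  have GS : \sum_(i < n.+1) theta ^+ i = 1 + theta * \sum_(i < n) theta ^+ i.
    rewrite big_ord_recl expr0 mulr_sumr; congr (_ + _).
    by apply: eq_bigr => i _; rewrite -exprS.
  rewrite /T GS (exprS theta); move: (theta ^+ n) (\sum_(i < n) _) => p G.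
  by have := eA n; lra.
suff [] : 0 <= T N /\ D N ^+ 2 <= N%:R * T N by [].
elim: N => [|N [TN IH]].
  by rewrite D0 /T big_ord0 mul0r mulr0 addr0 expr0 mul1r subrr expr0n.
have thT : 0 <= theta * T N by rewrite mulr_ge0.
split; first by have := TS N; have := sqr_ge0 (e N.+1); lra.
apply: (@le_trans _ _ ((sigma * D N + e N.+1) ^+ 2)).
  by rewrite ler_pXn2r// nnegrE// (le_trans _ (De N)).
apply: (@le_trans _ _ (N.+1%:R * (theta * T N + e N.+1 ^+ 2))); last first.
  by rewrite ler_wpM2l.
have sD : (sigma * D N) ^+ 2 <= N%:R * (theta * T N).
  by rewrite exprMn [leRHS]mulrCA; apply: ler_pM => //; exact: sqr_ge0.
rewrite -natr1; case: (posnP N) => [N0|N0].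
  have -> : D N = 0 by rewrite N0.
  have -> : N%:R = 0 :> R by rewrite N0.
  by lra.
have {}N0 : 0 < N%:R :> R by rewrite ltr0n.
rewrite -(ler_pM2l N0); have := sqr_ge0 (sigma * D N - N%:R * e N.+1).
have := ler_wpM2l (ltW N0) sD; lra.
Qed.

(** A left Riemann sum of a nondecreasing function lies below its integral. *)
Lemma riemann_sum_exp_primitive (a h : R) N : 0 <= a -> 0 <= h ->
  h * (\sum_(i < N) expR (a * h) ^+ i) <= exp_primitive a (N%:R * h).
Proof.
move=> a0 h0; elim: N => [|N IH].
  by rewrite big_ord0 mulr0 mul0r exp_primitive0.
rewrite big_ord_recr/= mulrDr -natr1 mulrDl mul1r exp_primitiveD lerD//.
rewrite mulrC -expRM_natl mulr_natl -mulrnAr -mulr_natl ler_pM2l ?expR_gt0//.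
exact: exp_primitive_ge.
Qed.

(** Here [a], [b] are the slopes before and after the step, [w] its squared length, [dphi] the
    energy drop and [e2] the squared local error. The energy hypothesis replaces [dphi] by
    [w / tau], whose negative coefficient the slope hypothesis turns into a multiple of [b ^+ 2]. *)
Lemma one_step_estimate (tau eta mu eps a b w dphi e2 : R) :
  0 < tau -> 0 <= eta -> 0 <= mu -> 0 <= eps -> 0 <= w ->
  let gamma := 2 * eta + 3 * mu in
  let q := 1 - (2 * eta + 2 * mu) * tau in
  4 * gamma * tau <= 1 ->
  tau * (1 - 2^-1 * eta * tau) ^+ 2 * b ^+ 2 <= w / tau + eps ->
  (1 - (eta + mu) / 2 * tau) * (w / tau) <= dphi + eps ->
  e2 <= expR (mu * tau) * w - 2 * exp_primitive mu tau * dphi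
        + a ^+ 2 * exp_primitive mu tau ^+ 2 ->
  e2 <= expR (2 * gamma * tau) * (q * tau ^+ 2 * a ^+ 2) - q * tau ^+ 2 * b ^+ 2
        + 4 * eps * tau.
Proof.
move=> tau0 eta0 mu0 eps0 w0 gamma q gtau hb hphi; rewrite expR_exp_primitive.
set E := exp_primitive mu tau => he2.
have E1 : tau <= E by apply: exp_primitive_ge => //; exact: ltW.
set s := expR (mu * tau); have E2 : E <= tau * s by exact: exp_primitive_le.
have etat : 0 <= eta * tau by rewrite mulr_ge0// ltW.
have mut : 0 <= mu * tau by rewrite mulr_ge0// ltW.
rewrite /gamma in gtau.
(* With 3/2 the term [2 * E * eps] costs 3 eps tau; the slope hypothesis adds one more, giving 4 eps
   tau. *)
have E3 : E <= 3 / 2 * tau.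
  have := expR_ge1Dx (- (mu * tau)); rewrite expRN -/s => s1.
  have s0 : 0 < s by exact: expR_gt0.
  have s2 : s <= 3 / 2.
    move: s1; rewrite -(ler_pM2r s0) mulVf ?gt_eqF// => s1.
    have : mu * tau * s <= 3^-1 * s by rewrite ler_pM2r//; lra.
    by lra.
  by rewrite (le_trans E2)// mulrC ler_pM2r.
pose u := w / tau; have u0 : 0 <= u by rewrite divr_ge0// ltW.
have wE : w = u * tau by rewrite /u divfK// gt_eqF.
rewrite -/u in hb hphi.
pose c := 1 - (eta + 2 * mu) * tau.
have c0 : 0 <= c by rewrite /c; lra.
have c1 : c <= 1 by rewrite /c; lra.
have q0 : 0 <= q by rewrite /q; lra.
(* Since (1 - x/2)^2 >= 1 - x for x = eta tau, this follows by expanding c (1 - eta tau), which is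
   [q] plus nonnegative terms. *)
have cq : q <= c * (1 - 2^-1 * eta * tau) ^+ 2.
  have : 0 <= (eta * tau) ^+ 2 by exact: sqr_ge0.
  have : 0 <= (eta * tau) * (mu * tau) by exact: mulr_ge0.
  have : 1 - eta * tau <= (1 - 2^-1 * eta * tau) ^+ 2.
    by have := sqr_ge0 (eta * tau); lra.
  move/(ler_wpM2l c0) => ch ? ?; apply: le_trans ch; rewrite /c /q; lra.
(* The coefficient is nonincreasing in [E] because (eta + 2 mu) tau <= 2, and equals [- (c * tau)]
   at [E = tau]. *)
have coef : (tau - 2 * E + (eta + 2 * mu) * tau * E) * u <= - (c * tau) * u.
  apply: ler_wpM2r => //.
  have : 0 <= (E - tau) * (2 - (eta + 2 * mu) * tau) by rewrite mulr_ge0; lra.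
  by rewrite /c; lra.
have he : e2 <= - (c * tau) * u + 2 * E * eps + a ^+ 2 * E ^+ 2.
  have := ler_wpM2l (le_trans (ltW tau0) E1) hphi.
  by move: he2; rewrite wE; lra.
have hu : q * tau ^+ 2 * b ^+ 2 - eps * tau <= c * tau * u.
  have b0 : 0 <= tau ^+ 2 * b ^+ 2 by rewrite mulr_ge0 ?sqr_ge0.
  have := ler_wpM2r b0 cq.
  have := ler_wpM2l (mulr_ge0 c0 (ltW tau0)) hb.
  have := ler_wpM2r (mulr_ge0 eps0 (ltW tau0)) c1.
  by lra.
have Ee : E * eps <= 3 / 2 * tau * eps by exact: ler_wpM2r.
have Ea : E ^+ 2 * a ^+ 2 <= expR (2 * gamma * tau) * q * tau ^+ 2 * a ^+ 2.
  apply: ler_wpM2r; first exact: sqr_ge0.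
  apply: (@le_trans _ _ ((tau * s) ^+ 2)).
    rewrite ler_pXn2r// nnegrE; first by rewrite (le_trans (ltW tau0)).
    by rewrite mulr_ge0 ?expR_ge0// ltW.
  rewrite exprMn mulrC; apply: ler_wpM2r; first exact: sqr_ge0.
  pose z := (2 * eta + 2 * mu) * tau.
  have z0 : 0 <= z by rewrite /z; lra.
  have z1 : z <= 2^-1 by rewrite /z; lra.
  (* q = 1 - z and 1 <= (1 - z) (1 + 2 z) <= (1 - z) e^(2 z) for 0 <= z <= 1/2 *)
  have -> : expR (2 * gamma * tau) = s ^+ 2 * expR (2 * z).
    by rewrite /s -expRM_natl -expRD; congr expR; rewrite /gamma /z; ring.
  rewrite -mulrA ler_peMr ?sqr_ge0//.
  have : (1 + 2 * z) * q <= expR (2 * z) * q by rewrite ler_wpM2r// expR_ge1Dx.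
  apply: le_trans; have : 0 <= z * (1 - 2 * z) by rewrite mulr_ge0; lra.
  by rewrite /q -/z; lra.
by move: he hu Ee Ea; lra.
Qed.

End discrete_estimates.

(** * Summation along the grid and passage to time t *)

Theorem theorem5p5 (R : realType) (X : metricType R) (phi : X -> \bar R)
    (phi_proper : proper_functional phi)
    (phi_lsc : lower_semicontinuous phi)
    (lambda : R) (lambda_le0 : lambda <= 0)
    (D : set X) (D_sub : D `<=` closure (Dom phi))
    (S : R -> X -> X) (S_flow : EVI_gradient_flow lambda phi D S)
    (tau eta eps : R) (tau_gt0 : 0 < tau) (eta_ge0 : 0 <= eta)
    (eps_ge0 : 0 <= eps) :
  let gamma := 2 * eta - 3 * lambda in
  4 * gamma * tau <= 1 ->
  forall U : nat -> X,
  (forall n, D (U n) /\ Dom (metric_slope phi) (U n)) ->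
  (forall n, (1 <= n)%N ->
     ((tau * (1 - 2^-1 * eta * tau) ^+ 2)%:E * metric_slope phi (U n) ^+ 2
        <= (mdist (U n) (U n.-1) ^+ 2 / tau + eps)%:E)%E) ->
  (forall n, (1 <= n)%N ->
     (((1 - (eta - lambda) / 2 * tau) * (mdist (U n) (U n.-1) ^+ 2 / tau))%:E
        <= phi (U n.-1) - phi (U n) + eps%:E)%E) ->
  forall u0, D u0 -> forall t, 0 < t ->
  let t_tau := time_ceil tau t in
  ((mdist (S t u0) (pc_interpolant tau U t))%:E
    <= (expR (- lambda * t) * mdist u0 (U 0%N))%:E
     + ((Num.sqrt (tau * t_tau) + t_tau - t) * expR (gamma * t_tau))%:E
         * metric_slope phi (U 0%N)
     + (2 * Num.sqrt (eps / tau * t_tau * expR_primitive (2 * gamma) t_tau))%:E)%E.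
Proof.
move=> gamma gtau U DU slopeU phiU u0 Du0 t t0; cbv zeta; set t_tau := time_ceil tau t.
pose mu := - lambda; have mu0 : 0 <= mu by rewrite oppr_ge0.
have gammaE : gamma = 2 * eta + 3 * mu by rewrite /gamma /mu; ring.
have gamma0 : 0 <= gamma by rewrite gammaE; lra.
have flow : EVI_gradient_flow (- mu) phi D S by rewrite opprK.
have DUn n : D (U n) by case: (DU n).
have slU n := (DU n).2.
pose a n := fine (metric_slope phi (U n)).
have aE n : metric_slope phi (U n) = (a n)%:E.
  by have [_ _] := metric_slopeP (slU n).
have a0 n : 0 <= a n by have [] := metric_slopeP (slU n).
have DomU n : Dom phi (U n) by have [] := metric_slopeP (slU n).
have [[k tk ttk] kmin] := time_ceil_min t tau_gt0; rewrite -/t_tau in tk ttk kmin.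
(* Positivity of [t] excludes index 0; minimality then places [t] in the grid interval ending at (N
   + 1) tau. *)
case: k tk => [tk|N tk]; first by move: ttk; rewrite tk mul0r leNgt t0.
have UN : pc_interpolant tau U t = U N.+1.
  apply: pc_interpolantE => //; rewrite -tk ttk andbT -natr1 addrK ltNge.
  by apply/negP => /kmin; rewrite tk ler_pM2r// ler_nat ltnn.
have T0 : 0 < t_tau by exact: lt_le_trans ttk.
pose sigma := expR (mu * tau); pose theta := expR (2 * gamma * tau).
pose q := 1 - (2 * eta + 2 * mu) * tau.
pose Dn n := mdist (S (n%:R * tau) (U 0)) (U n).
pose e n := mdist (S tau (U n.-1)) (U n).
pose A n := q * tau ^+ 2 * a n ^+ 2.
have gtau' : 4 * (2 * eta + 3 * mu) * tau <= 1 by rewrite -gammaE.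
have etau0 : 0 <= eta * tau by rewrite mulr_ge0// ltW.
have mtau0 : 0 <= mu * tau by rewrite mulr_ge0// ltW.
have q0 : 0 <= q by rewrite /q; lra.
have q1 : q <= 1 by rewrite /q; lra.
(* Triangle inequality through [S tau (U n)]: the old error is expanded by the contraction estimate,
   the new one is local. *)
have DnS n : Dn n.+1 <= sigma * Dn n + e n.+1.
  rewrite /Dn /e -natr1 mulrDl mul1r (flowD flow) ?mulr_ge0 ?(ltW tau_gt0)//.
  apply: le_trans (metric_triangle _ (S tau (U n)) _) _; rewrite lerD2r.
  apply: (flow_contraction phi_proper phi_lsc mu0 flow); rewrite ?(ltW tau_gt0)//.
  by apply: (flow_in flow) => //; rewrite mulr_ge0// ltW.
have eA n : e n.+1 ^+ 2 <= theta * A n - A n.+1 + 4 * eps * tau.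
  have h1 : tau * (1 - 2^-1 * eta * tau) ^+ 2 * a n.+1 ^+ 2
      <= mdist (U n.+1) (U n) ^+ 2 / tau + eps.
    by have := slopeU n.+1 isT; rewrite aE -EFin_expe -EFinM lee_fin.
  have h2 : (1 - (eta + mu) / 2 * tau) * (mdist (U n.+1) (U n) ^+ 2 / tau)
      <= fine (phi (U n)) - fine (phi (U n.+1)) + eps.
    have := phiU n.+1 isT; rewrite succnK.
    by rewrite (DomE phi_proper (DomU n)) (DomE phi_proper (DomU n.+1)) -EFinB -EFinD lee_fin.
  have := flow_local_error phi_proper phi_lsc mu0 flow (DUn n) (slU n) (DomU n.+1) (ltW tau_gt0).
  rewrite (metric_sym (U n) (U n.+1)) -/(a n) => h3.
  rewrite /theta gammaE.
  exact: (one_step_estimate tau_gt0 eta_ge0 mu0 eps_ge0 (sqr_ge0 _) gtau' h1 h2 h3).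
have st : sigma ^+ 2 <= theta.
  by rewrite /sigma /theta -expRM_natl ler_expR gammaE; lra.
have Dn0 : Dn 0 = 0 by rewrite /Dn mul0r (flow0 flow)// mdistxx.
have DN := discrete_gronwall (expR_ge0 _) st Dn0 (fun n => mdist_ge0 _ _) DnS eA N.+1.
rewrite UN aE expR_primitiveE//.
set I := exp_primitive _ _; set P := Num.sqrt (tau * t_tau); set Q := Num.sqrt _.
rewrite -EFinM -!EFinD lee_fin.
have N0 : 0 <= N.+1%:R :> R by [].
have I0 : 0 <= I.
  by apply: le_trans (exp_primitive_ge _ (ltW T0)); rewrite ?mulr_ge0// ltW.
have thetaN : theta ^+ N.+1 = expR (gamma * t_tau) ^+ 2.
  by rewrite /theta -!expRM_natl tk; congr expR; ring.
have P2 : P ^+ 2 = N.+1%:R * tau ^+ 2.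
  by rewrite sqr_sqrtr ?mulr_ge0 ?ltW// tk; ring.
have Q2 : Q ^+ 2 = N.+1%:R * eps * I.
  rewrite sqr_sqrtr; last by rewrite !mulr_ge0 ?invr_ge0// ltW.
  by rewrite {1}tk; field; rewrite gt_eqF.
have DNPQ : Dn N.+1 <= P * expR (gamma * t_tau) * a 0 + 2 * Q.
  have P0 : 0 <= P * expR (gamma * t_tau) * a 0 by rewrite !mulr_ge0 ?sqrtr_ge0 ?expR_ge0.
  have Q0 : 0 <= Q by exact: sqrtr_ge0.
  have PQ0 : 0 <= P * expR (gamma * t_tau) * a 0 + 2 * Q by rewrite addr_ge0// mulr_ge0.
  rewrite -(@ler_pXn2r _ 2) ?nnegrE ?PQ0 ?mdist_ge0//.
  (* Superadditivity of squares of nonnegative numbers separates the slope and [eps] contributions;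
     what remains uses q <= 1, A_(N+1) >= 0 and the Riemann sum bound. *)
  apply: (@le_trans _ _ ((P * expR (gamma * t_tau) * a 0) ^+ 2 + (2 * Q) ^+ 2)); last first.
    by have := mulr_ge0 P0 Q0; lra.
  have -> : (P * expR (gamma * t_tau) * a 0) ^+ 2 + (2 * Q) ^+ 2 =
      N.+1%:R * (theta ^+ N.+1 * (tau ^+ 2 * a 0 ^+ 2) + 4 * (eps * I)).
    by rewrite !exprMn P2 Q2 thetaN; ring.
  apply: (le_trans DN); apply: ler_wpM2l => //; apply: lerD.
    have AN : 0 <= A N.+1 by exact: mulr_ge0 (mulr_ge0 q0 (sqr_ge0 _)) (sqr_ge0 _).
    have : theta ^+ N.+1 * (tau ^+ 2 * a 0 ^+ 2) * q <= theta ^+ N.+1 * (tau ^+ 2 * a 0 ^+ 2).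
      apply: ler_piMr q1; apply: mulr_ge0; first by rewrite exprn_ge0// expR_ge0.
      exact: mulr_ge0 (sqr_ge0 _) (sqr_ge0 _).
    move: AN; rewrite /A; move: (theta ^+ N.+1) => p; lra.
  have : tau * (\sum_(i < N.+1) theta ^+ i) <= I.
    rewrite /I tk; apply: riemann_sum_exp_primitive; last exact: ltW.
    by rewrite mulr_ge0.
  move=> /(ler_wpM2l eps_ge0); move: (\sum_(i < N.+1) _) => G; lra.
(* E(t_tau) - E(t) = e^(mu t) E(t_tau - t) <= (t_tau - t) e^(mu t_tau), and mu <= gamma. *)
have St : mdist (S t (U 0)) (S t_tau (U 0)) <= (t_tau - t) * expR (gamma * t_tau) * a 0.
  have := flow_displacement phi_proper phi_lsc mu0 flow (DUn 0) (slU 0) (ltW t0) ttk.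
  move=> /le_trans; apply; rewrite -/(a 0) mulrC; apply: ler_wpM2r => //.
  have -> : exp_primitive mu t_tau - exp_primitive mu t =
      expR (mu * t) * exp_primitive mu (t_tau - t).
    by apply/eqP; rewrite subr_eq addrC -exp_primitiveD subrKC.
  have := ler_wpM2l (expR_ge0 (mu * t)) (exp_primitive_le (t_tau - t) mu0).
  move=> /le_trans; apply.
  rewrite mulrCA -expRD -mulrDr subrKC; apply: ler_wpM2l; first by rewrite subr_ge0.
  by rewrite ler_expR; apply: ler_wpM2r; [exact: ltW|rewrite gammaE; lra].
have uU := flow_contraction phi_proper phi_lsc mu0 flow Du0 (DUn 0) (ltW t0).
(* The path runs from S_t u0 through S_t U^0 and S_(t_tau) U^0 to U^(N+1), one term of the estimate
   per leg, the slope term being shared by the last two. *)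
apply: le_trans (metric_triangle _ (S t (U 0)) _) _.
apply: le_trans (lerD uU (metric_triangle _ (S t_tau (U 0)) _)) _.
have -> : mdist (S t_tau (U 0)) (U N.+1) = Dn N.+1 by rewrite /Dn -tk.
by rewrite -/mu; move: St DNPQ; lra.
Qed.
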